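(* Fix an odd integer $l=2m+1$ with $m>0$. For all integers $i,j$, $$[i]^4[2j]+[j]^4[2i]+[2i][2j]+[i+j]^2[i-j]^2=0$$ in $\mathbb{Z}/2[[x]]$.
   Context: For an integer $i$, $[i]=\sum x^{n^2}\in\mathbb{Z}/2[[x]]$, summed over all $n\in\mathbb{Z}$ with $n\equiv i\pmod l$. *)

(* Defs.v *)
From HB Require Import structures.
From mathcomp Require Import all_boot all_order all_algebra.
From mathcomp Require Import all_classical.

Set Implicit Arguments.
Unset Strict Implicit.
Unset Printing Implicit Defensive.

Import Order.TTheory GRing.Theory Num.Theory.

Local Open Scope classical_set_scope.
Local Open Scope ring_scope.

(* Formal power series R[[x]], as a wrapper around coefficient sequences: the
   wrapper keeps the Cauchy product apart from the pointwise product that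
   nat -> R already carries. *)
Record fps (R : Type) := Fps { coefs : nat -> R }.

Lemma fpsP (R : Type) (f g : fps R) : coefs f =1 coefs g <-> f = g.
Proof.
split=> [|-> //]; case: f g => f [g] /= fg; congr Fps; exact/funext.
Qed.

HB.instance Definition _ (R : Type) := gen_eqMixin (fps R).
HB.instance Definition _ (R : Type) := gen_choiceMixin (fps R).

Section FpsRing.
Variable R : comNzRingType.
Implicit Types f g h : fps R.

Definition fps_zero : fps R := Fps (fun=> 0).
Definition fps_opp f : fps R := Fps (fun n => - coefs f n).
Definition fps_add f g : fps R := Fps (fun n => coefs f n + coefs g n).
Definition fps_one : fps R := Fps (fun n => (n == 0%N)%:R).
Definition fps_mul f g : fps R :=
  Fps (fun n => \sum_(i < n.+1) coefs f i * coefs g (n - i)).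

Fact fps_addA : associative fps_add.
Proof. by move=> f g h; apply/fpsP => n /=; rewrite addrA. Qed.
Fact fps_addC : commutative fps_add.
Proof. by move=> f g; apply/fpsP => n /=; rewrite addrC. Qed.
Fact fps_add0 : left_id fps_zero fps_add.
Proof. by move=> f; apply/fpsP => n /=; rewrite add0r. Qed.
Fact fps_addN : left_inverse fps_zero fps_opp fps_add.
Proof. by move=> f; apply/fpsP => n /=; rewrite addNr. Qed.

HB.instance Definition _ :=
  GRing.isZmodule.Build (fps R) fps_addA fps_addC fps_add0 fps_addN.

Definition fps_trunc (N : nat) f : {poly R} := \poly_(i < N) coefs f i.

Lemma coef_trunc N f i : (i < N)%N -> (fps_trunc N f)`_i = coefs f i.
Proof. by move=> iN; rewrite coef_poly iN. Qed.

Lemma coef_trunc_mul N f g i : (i < N)%N ->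
  coefs (fps_mul f g) i = (fps_trunc N f * fps_trunc N g)`_i.
Proof.
move=> iN; rewrite coefM /=; apply: eq_bigr => j _.
rewrite !coef_trunc //; first exact: leq_ltn_trans (leq_subr _ _) iN.
by apply: leq_ltn_trans iN; rewrite -ltnS.
Qed.

Fact fps_mulC : commutative fps_mul.
Proof.
by move=> f g; apply/fpsP => n; rewrite !(@coef_trunc_mul n.+1) // mulrC.
Qed.

Fact fps_mulA : associative fps_mul.
Proof.
move=> f g h; apply/fpsP => n; rewrite !(@coef_trunc_mul n.+1) //.
transitivity ((fps_trunc n.+1 f * (fps_trunc n.+1 g * fps_trunc n.+1 h))`_n).
  rewrite !(coefM (fps_trunc n.+1 f)); apply: eq_bigr => j _; congr (_ * _).
  have jn : (n - j < n.+1)%N by rewrite ltnS leq_subr.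
  by rewrite coef_trunc // (coef_trunc_mul _ _ jn).
rewrite mulrA !coefMr; apply: eq_bigr => j _; congr (_ * _).
have jn : (n - j < n.+1)%N by rewrite ltnS leq_subr.
by rewrite coef_trunc // (coef_trunc_mul _ _ jn).
Qed.

Fact fps_mul1 : left_id fps_one fps_mul.
Proof.
move=> f; apply/fpsP => n /=; rewrite big_ord_recl /= mul1r subn0.
by rewrite big1 ?addr0 // => i _; rewrite mul0r.
Qed.

Fact fps_mulDl : left_distributive fps_mul fps_add.
Proof.
move=> f g h; apply/fpsP => n /=; rewrite -big_split /=.
by apply: eq_bigr => i _; rewrite mulrDl.
Qed.

Fact fps_one_neq0 : fps_one != 0.
Proof.
by apply/eqP => /fpsP /(_ 0%N) /= /eqP; apply/negP; exact: oner_neq0.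
Qed.

HB.instance Definition _ := GRing.Zmodule_isComNzRing.Build (fps R)
  fps_mulA fps_mulC fps_mul1 fps_mulDl fps_one_neq0.

Definition fpsX : fps R := Fps (fun n => (n == 1%N)%:R).

Lemma coefs_Xn k n : coefs (fpsX ^+ k) n = (n == k)%:R.
Proof.
elim: k n => [|k IHk] n; first by rewrite expr0.
rewrite exprS; change (coefs (fps_mul fpsX (fpsX ^+ k)) n = (n == k.+1)%:R).
case: n => [|n] /=; first by rewrite big_ord_recl big_ord0 /= mul0r addr0.
rewrite !big_ord_recl /= mul0r add0r mul1r subSS subn0 IHk big1 ?addr0 //.
by move=> i _; rewrite mul0r.
Qed.

(* Coefficientwise sum of a family of power series.  It is the intended infinite
   sum only if each coefficient is nonzero for finitely many indices in A;
   otherwise the library's finite-support sum returns the junk value 0. *)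
Definition fps_sum (I : choiceType) (A : set I) (F : I -> fps R) : fps R :=
  Fps (fun k => \sum_(n \in A) coefs (F n) k).

End FpsRing.

Definition theta (l : nat) (i : int) : fps 'F_2 :=
  fps_sum [set n : int | (n = i %[mod l])%Z] (fun n => fpsX 'F_2 ^+ (`|n| ^ 2)).

Lemma theta_summable (A : set int) (k : nat) :
  finite_set (A `&` [set n | coefs (fpsX 'F_2 ^+ (`|n| ^ 2)) k != 0]).
Proof.
pose s := [seq Posz a | a <- iota 0 k.+1] ++ [seq - Posz a | a <- iota 0 k.+1].
apply: (@sub_finite_set _ _ [set` s]); last exact: finite_seq.
move=> n [_] /=; rewrite coefs_Xn; case: (k =P _) => [kn|_]; last by rewrite eqxx.
move=> _; have nk : (`|n| \in iota 0 k.+1)%N.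
  rewrite mem_iota /= add0n ltnS kn -mulnn.
  by case: `|n|%N => // a; rewrite leq_pmulr.
rewrite /s mem_cat; case: (lerP 0 n) => n0; apply/orP; [left|right].
  by apply/mapP; exists `|n|%N => //; rewrite gez0_abs.
by apply/mapP; exists `|n|%N => //; rewrite ltz0_abs // opprK.
Qed.

(* Main.v *)
(* Write [2i] = E_i + O_i, splitting the sum according to the parity of n.
   Squaring is additive in characteristic 2, so [i]^4 is the sum of x^((2n)^2)
   over n = i mod l; as l is odd, 2n runs through the even integers congruent
   to 2i, and [i]^4 = E_i.  Likewise [i+j]^2 [i-j]^2 is the sum of
   x^(2(a^2+b^2)) = x^((a+b)^2+(a-b)^2); as l is odd, (u, v) = (a+b, a-b) runs
   through the pairs of integers of equal parity with u = 2i and v = 2j mod l,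
   which gives E_i E_j + O_i O_j.  In the resulting polynomial in E_i, O_i, E_j,
   O_j every monomial has an even coefficient. *)
Require Import Defs.
From mathcomp Require Import all_boot all_order all_algebra.
From mathcomp Require Import all_classical.
From mathcomp Require Import zify ring.

Set Implicit Arguments.
Unset Strict Implicit.
Unset Printing Implicit Defensive.

Import Order.TTheory GRing.Theory Num.Theory.

Local Open Scope classical_set_scope.
Local Open Scope ring_scope.

Section WeightSeries.
Variable R : comNzRingType.

Lemma coefs_sum (I : Type) (s : seq I) (F : I -> fps R) k :
  coefs (\sum_(a <- s) F a) k = \sum_(a <- s) coefs (F a) k.
Proof. by elim/big_rec2: _ => // a f c _ <-. Qed.

(** Coefficient k of a product involves only coefficients up to k, so infinite sums can be
    multiplied through finite partial sums. *)
Lemma eq_coefs_mul {f f' g g' : fps R} {k} :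
  (forall n, (n <= k)%N -> coefs f n = coefs f' n) ->
  (forall n, (n <= k)%N -> coefs g n = coefs g' n) ->
  coefs (f * g) k = coefs (f' * g') k.
Proof.
move=> ff gg; apply: eq_bigr => i _.
by rewrite ff ?gg ?leq_subr // -ltnS.
Qed.

Lemma pchar_fps p : p \in [pchar R] -> p \in [pchar (fps R)].
Proof.
move=> /andP[p_prime /eqP p0]; apply/andP; split=> //; apply/eqP/fpsP => n.
have coefsMn (f : fps R) j : coefs (f *+ j) n = coefs f n *+ j.
  by elim: j => // j IH; rewrite !mulrS -IH.
by rewrite coefsMn -mulr_natr p0 mulr0.
Qed.

(** Generating function of the weight [w] on [A]. Each [theta l c] has this form, so that identities
    between series become reindexings. *)
Definition weight_series (I : choiceType) (A : set I) (w : I -> nat) : fps R :=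
  fps_sum A (fun a => fpsX R ^+ w a).

(** The bound [w a <= k], rather than an equality, lets a single finite list account for all
    coefficients up to degree k. *)
Definition locally_finite (I : choiceType) (A : set I) (w : I -> nat) :=
  forall k, finite_set (A `&` [set a | (w a <= k)%N]).

Lemma locally_finite_le (I : choiceType) (A B : set I) (w w' : I -> nat) :
  locally_finite B w -> A `<=` B -> (forall a, (w a <= w' a)%N) ->
  locally_finite A w'.
Proof.
move=> fB AB ww k; apply: sub_finite_set (fB k) => a [/AB Ba /= wk].
by split=> //=; apply: leq_trans (ww a) wk.
Qed.

Lemma locally_finiteX (I J : choiceType) (A : set I) (B : set J) w w' :
  locally_finite A w -> locally_finite B w' ->
  locally_finite (A `*` B) (fun p => w p.1 + w' p.2)%N.
Proof.
move=> fA fB k; apply: sub_finite_set (finite_setX (fA k) (fB k)).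
move=> [a b] [[/= Aa Bb] /= wk].
by split; split=> //=; apply: leq_trans wk; rewrite ?leq_addr ?leq_addl.
Qed.

Lemma locally_finite_seq {I : choiceType} {A : set I} {w : I -> nat} k :
  locally_finite A w ->
  exists s : seq I, [/\ uniq s, forall a, a \in s -> A a
    & forall a, A a -> (w a <= k)%N -> a \in s].
Proof.
move=> /(_ k) /finite_seqP[s sE].
have sP a : (a \in undup s) <-> A a /\ (w a <= k)%N.
  by rewrite mem_undup -[is_true (a \in s)]/([set` s] a) -sE.
exists (undup s); split; first exact: undup_uniq.
  by move=> a /sP[].
by move=> a Aa wk; apply/sP.
Qed.

(** An index of [A] missing from [s] has weight above k, so its monomial contributes nothing in
    degrees up to k. *)
Lemma coefs_weight_series (I : choiceType) (A : set I) (w : I -> nat)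
    (s : seq I) k :
  uniq s -> (forall a, a \in s -> A a) ->
  (forall a, A a -> (w a <= k)%N -> a \in s) ->
  forall n, (n <= k)%N ->
  coefs (weight_series A w) n = coefs (\sum_(a <- s) fpsX R ^+ w a) n.
Proof.
move=> us sA As n nk; rewrite coefs_sum fsbig_seq //.
apply/esym/fsbig_widen => // a [Aa /= /negP nas].
rewrite coefs_Xn; case: eqP => // nw.
by rewrite As // -nw in nas.
Qed.

(** Finite partial sums multiply out over pairs. A pair of total weight at most k has both weights
    at most k, so the product of the two lists contains it. *)
Lemma weight_seriesM (I J : choiceType) (A : set I) (B : set J) w w' :
  locally_finite A w -> locally_finite B w' ->
  weight_series A w * weight_series B w' =
  weight_series (A `*` B) (fun p => w p.1 + w' p.2)%N.
Proof.
move=> fA fB; apply/fpsP => k.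
have [s [us sA As]] := locally_finite_seq k fA.
have [t [ut tB Bt]] := locally_finite_seq k fB.
rewrite (eq_coefs_mul (coefs_weight_series us sA As)
  (coefs_weight_series ut tB Bt)).
rewrite (@coefs_weight_series _ _ _ [seq (a, b) | a <- s, b <- t] k) //.
- rewrite big_allpairs mulr_suml; congr (coefs _ k).
  apply: eq_bigr => a _; rewrite mulr_sumr.
  by apply: eq_bigr => b _; rewrite exprD.
- by apply: allpairs_uniq => // -[a b] [a' b'].
- by move=> _ /allpairsP[[a b] [/= /sA Aa /tB Bb ->]].
- move=> [a b] [/= Aa Bb] wk; apply: allpairs_f.
    by apply: As => //; apply: leq_trans wk; rewrite leq_addr.
  by apply: Bt => //; apply: leq_trans wk; rewrite leq_addl.
Qed.

(** Frobenius is additive on a finite partial sum. Since [w a <= w a * 2], the same list serves both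
    sides. *)
Lemma weight_series_sqr (I : choiceType) (A : set I) w :
  2%N \in [pchar R] -> locally_finite A w ->
  weight_series A w ^+ 2 = weight_series A (fun a => w a * 2)%N.
Proof.
move=> /pchar_fps ch2 fA; apply/fpsP => k.
have [s [us sA As]] := locally_finite_seq k fA.
have approx := coefs_weight_series us sA As.
rewrite expr2 (eq_coefs_mul approx approx) -expr2.
rewrite (@coefs_weight_series _ _ _ s k) //; last first.
  by move=> a Aa wk; apply: As => //; apply: leq_trans wk; rewrite leq_pmulr.
congr (coefs _ k); rewrite -(pFrobenius_autE ch2) raddf_sum /=.
by apply: eq_bigr => a _; rewrite pFrobenius_autE exprM.
Qed.

Lemma weight_series_split {I : choiceType} {A : set I} {w} (P : pred I) :
  locally_finite A w ->
  weight_series A w = weight_series (A `&` [set a | P a]) w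
    + weight_series (A `&` [set a | ~~ P a]) w.
Proof.
move=> fA; apply/fpsP => k.
have [s [us sA As]] := locally_finite_seq k fA.
rewrite [RHS]/= (@coefs_weight_series _ _ _ s k) //.
have filt (Q : pred I) :
    coefs (weight_series (A `&` [set a | Q a]) w) k
    = coefs (\sum_(a <- s | Q a) fpsX R ^+ w a) k.
  rewrite -big_filter; apply: coefs_weight_series; first exact: filter_uniq.
  - by move=> a; rewrite mem_filter => /andP[Qa /sA].
  - by move=> a [Aa /= Qa] /(As a Aa); rewrite mem_filter Qa.
  - exact: leqnn.
have := filt P; have := filt (fun a => ~~ P a).
rewrite /weight_series /= => -> ->.
by rewrite (bigID P).
Qed.

Lemma reindex_weight_series {I J : choiceType} {A : set I} {B : set J}
    (h : I -> J) w :
  set_bij A B h ->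
  weight_series B w = weight_series A (w \o h).
Proof. by move=> hbij; apply/fpsP => k; apply: reindex_fsbig hbij. Qed.

Lemma eq_weight_series {I : choiceType} {A : set I} w w' :
  w =1 w' -> weight_series A w = weight_series A w'.
Proof. by move=> /funext ->. Qed.

End WeightSeries.

Definition sqw (n : int) : nat := (`|n| ^ 2)%N.
Definition evenz : pred int := fun n => (2 %| n)%Z.

Lemma evenzD u v : evenz (u + v) = (evenz u == evenz v).
Proof. by rewrite /evenz; lia. Qed.

Lemma locally_finite_sqw (A : set int) : locally_finite A sqw.
Proof.
(* The list runs from -k to k, which suffices because |n| <= n^2 <= k. *)
move=> k; pose s := [seq (n%:Z - k%:Z) | n <- iota 0 (k.*2).+1].
apply: (@sub_finite_set _ _ [set` s]); last exact: finite_seq.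
move=> /= n [_ /= nk].
have nk' : (`|n| <= k)%N by apply: leq_trans nk; rewrite /sqw -mulnn; nia.
apply/mapP; exists (absz (n + k%:Z)); last by lia.
by rewrite mem_iota; lia.
Qed.

Theorem theorem3p6 (l m : nat) (hm : (0 < m)%N) (hl : l = (2 * m + 1)%N)
    (i j : int) :
  theta l i ^+ 4 * theta l (2 * j) + theta l j ^+ 4 * theta l (2 * i)
    + theta l (2 * i) * theta l (2 * j)
    + theta l (i + j) ^+ 2 * theta l (i - j) ^+ 2 = 0 :> fps 'F_2.
Proof.
pose C (c : int) := [set n : int | (n = c %[mod l])%Z].
have thetaE c : theta l c = weight_series 'F_2 (C c) sqw by [].
have ch2 : 2%N \in [pchar 'F_2] by exact: pchar_Fp.
have lf2 (A : set int) : locally_finite A (fun n => sqw n * 2)%N.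
  by apply: locally_finite_le (locally_finite_sqw A) _ _ => // n; lia.
pose Ev (c : int) := weight_series 'F_2 (C (2 * c) `&` [set n | evenz n]) sqw.
pose Od (c : int) :=
  weight_series 'F_2 (C (2 * c) `&` [set n | ~~ evenz n]) sqw.
have CE (c n : int) : C c n <-> exists q : int, n = c + q * l%:Z.
  rewrite /C /=; split.
    move=> /eqP; rewrite eqz_mod_dvd => /dvdzP[q nq]; exists q; lia.
  by move=> [q ->]; rewrite addrC modzMDl.
have theta_even c : theta l (2 * c) = Ev c + Od c.
  by rewrite thetaE; apply/weight_series_split/locally_finite_sqw.
have theta_pow4 c : theta l c ^+ 4 = Ev c.
  rewrite (exprM _ 2 2) thetaE weight_series_sqr //; last first.
    exact: locally_finite_sqw.
  rewrite weight_series_sqr // /Ev.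
  have bij2 : set_bij (C c) (C (2 * c) `&` [set n | evenz n]) (fun n => 2 * n).
    split.
    - move=> _ /CE[q ->]; split; last by rewrite /= /evenz dvdz_mulr.
      by apply/CE; exists (2 * q); ring.
    - by move=> a b _ _ ab; lia.
    - move=> n [/CE[q nq] /dvdzP[r nr]]; exists r; last by lia.
      (* From 2(r - c) = q(2m + 1), q is even and its half is r - c - qm. *)
      apply/CE; exists (r - c - q * m%:Z); nia.
  rewrite (reindex_weight_series _ _ bij2).
  by apply: eq_weight_series => n; rewrite /sqw /=; nia.
have theta_sqr_mul :
    theta l (i + j) ^+ 2 * theta l (i - j) ^+ 2 = Ev i * Ev j + Od i * Od j.
  rewrite !thetaE !weight_series_sqr //; try exact: locally_finite_sqw.
  rewrite !weight_seriesM //; try exact: locally_finite_sqw.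
  pose q (p : int * int) := (sqw p.1 + sqw p.2)%N.
  (* Equal parity of the two coordinates is encoded as evenness of their sum. *)
  pose D := (C (2 * i) `*` C (2 * j)) `&` [set p | evenz (p.1 + p.2)].
  have bijD : set_bij (C (i + j) `*` C (i - j)) D
      (fun p => (p.1 + p.2, p.1 - p.2)).
    split.
    - move=> [_ _] [/CE[r /= ->] /CE[s /= ->]]; split=> /=.
        by split; apply/CE; [exists (r + s) | exists (r - s)] => /=; ring.
      by apply/dvdzP; exists (i + j + r * l%:Z); ring.
    - by move=> [a b] [a' b'] _ _ [] ? ?; congr (_, _); lia.
    - move=> [u v] [[/CE[r /= ur] /CE[s /= vs]] /dvdzP[t /= uvt]].
      (* The preimage is ((u + v)/2, (u - v)/2). As l = 2m + 1 is odd, r + s and r - s are even; the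
         witnesses below are their halves. *)
      exists (t, u - t); last by rewrite /=; congr (_, _); lia.
      split; apply/CE; rewrite /=.
        by exists (t - i - j - (r + s) * m%:Z); nia.
      by exists (u - t - i + j - (r - s) * m%:Z); nia.
  have -> : weight_series 'F_2 (C (i + j) `*` C (i - j))
      (fun p => sqw p.1 * 2 + sqw p.2 * 2)%N = weight_series 'F_2 D q.
    rewrite (reindex_weight_series _ _ bijD).
    by apply: eq_weight_series => -[a b]; rewrite /q /sqw /=; nia.
  (* Within [D] the parity of the first coordinate determines that of the second, so both pieces are
     products of parity classes. *)
  rewrite (weight_series_split _ (fun p => evenz p.1)); last first.
    apply: locally_finite_le (locally_finiteX
      (locally_finite_sqw setT) (locally_finite_sqw setT)) _ _ => //.
  by congr (_ + _); congr (fps_sum _ _);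
    apply/seteqP; split=> -[u v]; rewrite /D /setI /setX /= evenzD;
    case: (evenz u); case: (evenz v); intuition.
rewrite theta_sqr_mul !theta_pow4 !theta_even.
have add2 (f : fps 'F_2) : f + f = 0 by exact: addrr_pchar2 (pchar_fps ch2) f.
(* [Ev i * Ev j] occurs four times and the other three products twice each; equal terms are paired
   for [add2]. *)
transitivity ((Ev i * Ev j + Ev i * Ev j) + (Ev i * Ev j + Ev i * Ev j)
  + (Ev i * Od j + Ev i * Od j) + (Od i * Ev j + Od i * Ev j)
  + (Od i * Od j + Od i * Od j)); first by ring.
by rewrite !add2.
Qed.
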